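(* Let $n\ge 1$ and let $d_1,\ldots,d_{n+1}$ be positive integers satisfying $$d_i\le \sum_{j\ne i}(d_j-1)\quad\text{for all } i\in\{1,\ldots,n+1\}.$$ Then for every prime number $p>0$, $$\mathcal{E}_p(d_1,\ldots,d_{n+1})\le \mathcal{E}_0(d_1,\ldots,d_{n+1}).$$
   Context: Let $k$ be a field of characteristic $p\ge 0$, and $f:=x_1+\cdots+x_n\in k[x_1,\ldots,x_n]$ (standard grading). For positive integers $d_1,\ldots,d_{n+1}$, a (homogeneous) relation on $x_1^{d_1},\ldots,x_n^{d_n},f^{d_{n+1}}$ is a tuple $\mathcal{A}=(a_1,\ldots,a_{n+1})^t$ of homogeneous polynomials with $a_1x_1^{d_1}+\cdots+a_nx_n^{d_n}+a_{n+1}f^{d_{n+1}}=0$ (all terms of the same degree). Its degree is $\deg(\mathcal{A}):=\deg(a_i)+d_i$ (independent of $i$ with $a_i\neq 0$). Writing $x_{n+1}:=f$, the relation is non-Koszul if $a_i\notin (x_j^{d_j}: j\ne i,\ 1\le j\le n+1)$ for some (equivalently for all) $i\in\{1,\ldots,n+1\}$. $\mathcal{E}_p(d_1,\ldots,d_{n+1})$ denotes the minimum of $\deg(\mathcal{A})$ over all non-Koszul relations $\mathcal{A}$; it depends on $k$ only through its characteristic $p$. *)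

(* Defs.v *)
From HB Require Import structures.
From mathcomp Require Import all_boot all_order all_algebra.
From mathcomp Require Import boolp.
From mathcomp Require Import mpoly.

Set Implicit Arguments.
Unset Strict Implicit.
Unset Printing Implicit Defensive.

Import GRing.Theory.
Local Open Scope ring_scope.

Section Relations.
Variables (k : fieldType) (n : nat).
Implicit Types (d : 'I_n.+1 -> nat) (a : 'I_n.+1 -> {mpoly k[n]}).

(* The n+1 linear forms, indexed from 0: the n variables, then, at index
   [ord_max], their sum f. *)
Definition form (i : 'I_n.+1) : {mpoly k[n]} :=
  if unlift ord_max i is Some j then 'X_j else \sum_(j < n) 'X_j.

(* The zero polynomial is homogeneous of every degree, so a zero component
   puts no constraint on D; for a nonzero one, deg (a i) + d i = D. *)
Definition is_relation d (D : nat) a : Prop :=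
  (forall i, a i != 0 -> exists2 e, a i \is e.-homog & (e + d i)%N = D) /\
  \sum_i a i * form i ^+ d i = 0.

(* Membership of p in the ideal generated by the form j ^+ d j, j != i. *)
Definition in_other_ideal d (i : 'I_n.+1) (p : {mpoly k[n]}) : Prop :=
  exists c : 'I_n.+1 -> {mpoly k[n]},
    p = \sum_(j | j != i) c j * form j ^+ d j.

Definition non_Koszul d a : Prop := exists i, ~ in_other_ideal d i (a i).

Definition non_Koszul_degree d (D : nat) : Prop :=
  exists2 a, is_relation d D a & non_Koszul d a.

(* In A = k[x_1, ..., x_n]/(x_i ^ d_i) the class of f is nilpotent and 1 != 0:
   for the largest N with f ^ N != 0 in A, a_{n+1} = f ^ N extends to a
   homogeneous non-Koszul relation. Vanishing in A is tested on monomials. *)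

Let f : {mpoly k[n]} := \sum_(j < n) 'X_j.

Let big_mon d (m : 'X_{1..n}) := [exists j : 'I_n, d (lift ord_max j) <= m j]%N.

Let all_big d (p : {mpoly k[n]}) := all (big_mon d) (msupp p).

Lemma form_lift j : form (lift ord_max j) = 'X_j.
Proof. by rewrite /form liftK. Qed.

Lemma form_max : form ord_max = f.
Proof. by rewrite /form unlift_none. Qed.

Lemma fX_homog N : f ^+ N \is N.-homog.
Proof.
rewrite -[N in N.-homog]mul1n; apply: dhomogMn.
by apply: rpred_sum => j _; rewrite dhomogX /= mdeg1.
Qed.

Lemma all_big_large d N : (\sum_(j < n) d (lift ord_max j) < N)%N ->
  all_big d (f ^+ N).
Proof.
move=> hN; apply/allP => m /(dhomog_mf (fX_homog N)) /= hm.
apply: contraLR hN => /existsPn /= hs; rewrite -leqNgt -hm mdegE.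
by apply: leq_sum => j _; apply: ltnW; rewrite ltnNge hs.
Qed.

Lemma last_nonvanishing d : (forall i, 0 < d i)%N ->
  exists2 N, ~~ all_big d (f ^+ N) & all_big d (f ^+ (N + d ord_max)).
Proof.
move=> hd.
have ex0 : exists N, ~~ all_big d (f ^+ N).
  exists 0%N; rewrite expr0 /all_big msupp1 /= andbT; apply/existsPn => j.
  by rewrite mnm0E -ltnNge.
have ub N : ~~ all_big d (f ^+ N) -> (N <= \sum_(j < n) d (lift ord_max j))%N.
  by apply: contraR; rewrite -ltnNge; apply: all_big_large.
case: (ex_maxnP ex0 ub) => N hN hmax; exists N => //.
by apply: contraT => /hmax; rewrite -[X in (_ <= X)%N]addn0 leq_add2l leqNgt hd.
Qed.

Lemma all_big_decomp d D (p : {mpoly k[n]}) : p \is D.-homog -> all_big d p ->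
  exists2 c : 'I_n -> {mpoly k[n]},
    forall j, c j != 0 -> exists2 e, c j \is e.-homog &
      (e + d (lift ord_max j))%N = D
  & p = \sum_j c j * 'X_j ^+ d (lift ord_max j).
Proof.
move=> /dhomog_mf hp /allP hb.
pose sel (m : 'X_{1..n}) := [pick j : 'I_n | d (lift ord_max j) <= m j]%N.
pose sh (j : 'I_n) := (U_(j) *+ d (lift ord_max j))%MM.
have sh_le m j : sel m = Some j -> (sh j <= m)%MM.
  rewrite /sel; case: pickP => // l hl [<-]; apply/mnm_lepP => q.
  rewrite mulmnE mnm1E; case: eqP => [<-|_]; last by rewrite mul0n.
  by rewrite mul1n.
have deg_sh j : mdeg (sh j) = d (lift ord_max j).
  by rewrite mdegMn mdeg1 mul1n.
pose c j := \sum_(m <- msupp p | sel m == Some j) p@_m *: 'X_[(m - sh j)].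
exists c => [j nz|].
  have hle : (d (lift ord_max j) <= D)%N.
    case: (boolP (has (fun m => sel m == Some j) (msupp p))) => [|/hasPn hn].
      case/hasP => m mp /eqP /sh_le hs; rewrite -(hp m mp) /= -(submK hs).
      by rewrite mdegD deg_sh leq_addl.
    by case/eqP: nz; rewrite /c big_seq_cond big1 // => m /andP[/hn /negbTE ->].
  exists (D - d (lift ord_max j))%N; last by rewrite subnK.
  rewrite /c big_seq_cond; apply: rpred_sum => m /andP[mp /eqP /sh_le hs].
  apply: rpredZ; rewrite dhomogX /= -(hp m mp) /= -{2}(submK hs) mdegD deg_sh.
  by rewrite addnK.
rewrite {1}(mpolyE p).
under [RHS]eq_bigr => j _ do rewrite /c mulr_suml big_mkcond /=.
rewrite exchange_big /= big_seq [RHS]big_seq; apply: eq_bigr => m mp.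
have [j hj] : exists j, sel m = Some j.
  have /existsP[l hl] := hb m mp.
  by rewrite /sel; case: pickP => [j _|/(_ l)]; [exists j | rewrite hl].
rewrite (bigD1 j) //= hj eqxx big1 => [|l hl]; last first.
  by case: eqP => // -[e]; rewrite e eqxx in hl.
by rewrite addr0 -scalerAl mpolyXn -mpolyXD submK // sh_le.
Qed.

Lemma in_other_ideal_max_big d (p : {mpoly k[n]}) :
  in_other_ideal d ord_max p -> all_big d p.
Proof.
case=> c ->; apply/allP => m; rewrite mcoeff_msupp; apply: contraR.
move=> /existsPn hs; rewrite raddf_sum /=; apply/eqP; apply: big1 => i.
case: (unliftP ord_max i) => [j ->|->]; last by rewrite eqxx.
move=> _; rewrite form_lift mpolyXn.
apply/eqP/contraT; rewrite -mcoeff_msupp (perm_mem (msuppMX _ _)).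
case/mapP => m' _ em; move: (hs j); rewrite em mnmDE mulmnE mnm1E eqxx mul1n.
by rewrite ?leq_addl ?leq_addr.
Qed.

Lemma non_Koszul_degree_ex d :
  (forall i, 0 < d i)%N -> exists D, `[< non_Koszul_degree d D >].
Proof.
move=> hd; have [N hN hbig] := last_nonvanishing hd.
have [c hc ec] := all_big_decomp (fX_homog _) hbig.
pose a i := if unlift ord_max i is Some j then - c j else f ^+ N.
exists (N + d ord_max)%N; apply/asboolP; exists a; last first.
  exists ord_max; rewrite /a unlift_none => /in_other_ideal_max_big.
  exact/negP.
split=> [i|].
  rewrite /a; case: unliftP => [j ->|-> _]; last by exists N => //; exact: fX_homog.
  by rewrite oppr_eq0 => /hc[e he <-]; exists e => //; rewrite dhomogN.
rewrite (bigD1_ord ord_max) //= /a unlift_none form_max -exprD ec -big_split /=.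
by apply: big1 => j _; rewrite liftK form_lift mulNr subrr.
Qed.

Definition min_non_Koszul_degree d (hd : forall i, (0 < d i)%N) : nat :=
  ex_minn (non_Koszul_degree_ex hd).

Lemma min_non_Koszul_degreeP d (hd : forall i, (0 < d i)%N) :
  non_Koszul_degree d (min_non_Koszul_degree hd) /\
  (forall D, non_Koszul_degree d D -> (min_non_Koszul_degree hd <= D)%N).
Proof.
rewrite /min_non_Koszul_degree; case: ex_minnP => D /asboolP hD hmin.
by split=> // D' /asboolP; apply: hmin.
Qed.

End Relations.

Arguments min_non_Koszul_degree k {n d} hd.

(* Main.v *)
Require Import Defs.
From mathcomp Require Import all_boot all_order all_algebra.
From mathcomp Require Import mpoly.

(** Let [A_k] be the quotient of [k[x_1, ..., x_n]] by the ideal generated by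
    the powers [x_j ^ d_j], and let [f] be the sum of the variables. The last
    entry [g] of a relation satisfies [g * f ^ d_{n+1} = 0] in [A_k], and any
    such homogeneous [g] is the last entry of some relation. Because powers of
    the variables form a regular sequence, the relation is non-Koszul exactly
    when [g != 0] in [A_k] ([non_Koszul_last] for the direction that is not
    immediate). Hence a non-Koszul relation of degree [e + d_{n+1}] exists iff
    multiplication by [f ^ d_{n+1}] is not injective on the part of [A_k] of
    degree [e]; [standard_annihilator] and [annihilator_non_Koszul_degree] are
    the two implications.

    The algebra [A_k] has a basis of monomials that does not depend on [k], and
    in this basis the multiplication is given by one matrix with integer
    entries. If it is injective over some field, a maximal minor is nonzero in
    that field, so it is a nonzero integer, and it stays nonzero in every field
    of characteristic zero ([row_free_map_intr]). Thus a failure of injectivity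
    in characteristic zero persists over every field, in the same degree
    ([annihilator_transfer]), which is the inequality between the minima. *)

Import GRing.Theory.
Local Open Scope ring_scope.

(** * Kernels of integer matrices over different fields *)

Lemma intr_eq0_pchar0 {k : fieldType} (z : int) :
  [pchar k] =i pred0 -> (z%:~R == 0 :> k) = (z == 0).
Proof.
move/pcharf0P => char0.
by case: z => m; rewrite ?NegzE ?mulrNz ?oppr_eq0 -pmulrn char0.
Qed.

(** Rank can only drop from characteristic zero to another field: full row rank
    is witnessed by a nonzero maximal minor, and that minor is the image of an
    integer. *)
Lemma row_free_map_intr {k k0 : fieldType} {r s : nat} (M : 'M[int]_(r, s)) :
    [pchar k0] =i pred0 ->
  row_free (map_mx (intr : int -> k) M) ->
  row_free (map_mx (intr : int -> k0) M).
Proof.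
move=> char0 freeM.
have fullMT : row_full (map_mx (intr : int -> k) M)^T.
  by rewrite /row_full mxrank_tr.
pose h := fullrankfun fullMT.
have := fullrowsub_free fullMT.
rewrite -/h row_free_unit map_trmx -map_mxsub unitmxE unitfE det_map_mx.
move=> minor.
have minor0 : row_free (rowsub h (map_mx (intr : int -> k0) M)^T)^T.
  rewrite row_free_unit unitmx_tr map_trmx -map_mxsub unitmxE unitfE det_map_mx.
  rewrite intr_eq0_pchar0 //.
  by apply: contraNneq minor => ->; rewrite rmorph0.
apply: inj_row_free => v vM; apply/eqP; rewrite -(mulmx_free_eq0 _ minor0).
apply/eqP/rowP => j; rewrite !mxE.
have := congr1 (fun w : 'rV_s => w 0 (h j)) vM; rewrite !mxE => vM0.
rewrite -[RHS]vM0; by apply: eq_bigr => i _; rewrite !mxE.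
Qed.

Lemma mcoeffMX_eq0 {k : fieldType} {n : nat} (q : {mpoly k[n]})
    (s m : 'X_{1..n}) :
  ~~ (s <= m)%MM -> (q * 'X_[s])@_m = 0.
Proof.
move=> nle; apply/eqP; rewrite mcoeff_eq0 (perm_mem (msuppMX _ _)).
by apply: contra nle => /mapP[m' _ ->]; rewrite lem_addr ?lem_addl.
Qed.

(** The conditions on [g] form a linear system, with integer coefficients, in
    the coefficients of [g] at the monomials of [g0]. The predicate [P] selects
    the monomials that survive in a quotient by a monomial ideal, so the
    conclusion keeps a nontrivial annihilator of [F] in that quotient while
    changing the field. *)
Lemma annihilator_transfer {k0 k : fieldType} {n : nat} (F : {mpoly int[n]})
    (P : pred 'X_{1..n}) (g0 : {mpoly k0[n]}) :
    [pchar k0] =i pred0 -> g0 != 0 ->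
    (forall m, P m -> (g0 * map_mpoly intr F)@_m = 0) ->
  exists g : {mpoly k[n]}, [/\ g != 0, {subset msupp g <= msupp g0} &
    forall m, P m -> (g * map_mpoly intr F)@_m = 0].
Proof.
move=> char0 g0_neq0 g0F.
pose rs := msupp g0; pose r i : 'X_{1..n} := nth 0%MM rs i.
(* Outside [cs], the coefficient at a monomial satisfying [P] of a multiple of
   [F] by a combination of the monomials of [rs] is zero, so finitely many
   columns suffice. *)
pose cs := [seq m <- flatten [seq msupp ('X_[m] * F) | m <- rs] | P m].
pose c j : 'X_{1..n} := nth 0%MM cs j.
pose M : 'M[int]_(size rs, size cs) := \matrix_(i, j) ('X_[(r i)] * F)@_(c j).
pose mon (K : fieldType) (v : 'rV[K]_(size rs)) : {mpoly K[n]} :=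
  \sum_i v 0 i *: 'X_[(r i)].
have coefE (K : fieldType) (v : 'rV[K]_(size rs)) m :
    (mon K v * map_mpoly intr F)@_m = \sum_i v 0 i * (('X_[(r i)] * F)@_m)%:~R.
  rewrite /mon mulr_suml raddf_sum /=; apply: eq_bigr => i _.
  rewrite -scalerAl mcoeffZ; congr (_ * _).
  by rewrite -mcoeff_map_mpoly rmorphM /= map_mpolyX.
have monE (K : fieldType) (v : 'rV[K]_(size rs)) (i : 'I_(size rs)) :
    (mon K v)@_(r i) = v 0 i.
  rewrite /mon raddf_sum /= (bigD1 i) //= big1 => [|j ji].
    by rewrite mcoeffZ mcoeffX eqxx mulr1 addr0.
  by rewrite mcoeffZ mcoeffX nth_uniq ?msupp_uniq // val_eqE (negbTE ji) mulr0.
have mon_supp (K : fieldType) (v : 'rV[K]_(size rs)) :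
    {subset msupp (mon K v) <= rs}.
  move=> m; rewrite mcoeff_msupp; apply: contraR => mrs.
  rewrite /mon raddf_sum /= big1 // => i _; rewrite mcoeffZ mcoeffX.
  case: eqP => [e|]; last by rewrite mulr0.
  by case/negP: mrs; rewrite -e mem_nth.
have mon_g0 : mon k0 (\row_i g0@_(r i)) = g0.
  apply/mpolyP => m; case: (boolP (m \in rs)) => mrs.
    have lt := mrs; rewrite -index_mem in lt.
    by rewrite -[m](nth_index 0%MM mrs) (monE _ _ (Ordinal lt)) mxE.
  by rewrite !memN_msupp_eq0 //; apply: contra mrs => /mon_supp.
have not_free : ~~ row_free (map_mx (intr : int -> k) M).
  apply: contra g0_neq0 => /(row_free_map_intr (k0 := k0) _ char0) free0.
  rewrite -mon_g0.
  suff /eqP -> : \row_i g0@_(r i) == 0 :> 'rV[k0]_(size rs).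
    by rewrite /mon big1 // => i _; rewrite mxE scale0r.
  rewrite -(mulmx_free_eq0 _ free0); apply/eqP/rowP => j.
  have /g0F : P (c j).
    by have := mem_nth 0%MM (ltn_ord j); rewrite mem_filter => /andP[].
  rewrite -{1}mon_g0 coefE => coef0; rewrite [RHS]mxE -[RHS]coef0 mxE.
  by apply: eq_bigr => i _; rewrite !mxE.
move: not_free; rewrite -kermx_eq0 => /rowV0Pn[v /sub_kermxP vM v_neq0].
exists (mon k v); split=> // [|m Pm].
  apply: contra v_neq0 => /eqP mon0; apply/eqP/rowP => i.
  by rewrite -monE mon0 mcoeff0 mxE.
rewrite coefE; case: (boolP (m \in cs)) => mcs.
  have lt := mcs; rewrite -index_mem in lt.
  have := congr1 (fun w : 'rV_(size cs) => w 0 (Ordinal lt)) vM.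
  rewrite !mxE /= => vM0; rewrite -[RHS]vM0.
  by apply: eq_bigr => i _; rewrite !mxE /c /= nth_index.
apply: big1 => i _; rewrite [X in X%:~R]memN_msupp_eq0 ?mulr0 //.
apply: contra mcs => mX; rewrite mem_filter Pm; apply/flattenP.
by exists (msupp ('X_[(r i)] * F)) => //; apply: map_f; rewrite mem_nth.
Qed.

(** * Relations and the last entry *)

Lemma in_other_ideal_term {k : fieldType} {n : nat} (d : 'I_n.+1 -> nat)
    (i j : 'I_n.+1) (q : {mpoly k[n]}) :
  j != i -> in_other_ideal d i (q * Defs.form k j ^+ d j).
Proof.
move=> ji; exists (fun l => if l == j then q else 0).
rewrite (bigD1 j) //= eqxx big1 ?addr0 // => l /andP[_ /negbTE ->].
by rewrite mul0r.
Qed.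

Lemma in_other_ideal_sum {k : fieldType} {n : nat} (d : 'I_n.+1 -> nat)
    (i : 'I_n.+1) (I : Type) (r : seq I) (P : pred I) (q : I -> {mpoly k[n]}) :
    (forall x, P x -> in_other_ideal d i (q x)) ->
  in_other_ideal d i (\sum_(x <- r | P x) q x).
Proof.
move=> hq; elim/big_ind: _ => //.
  by exists (fun=> 0); rewrite big1 // => j _; rewrite mul0r.
move=> p1 p2 [c1 ->] [c2 ->]; exists (fun j => c1 j + c2 j).
by rewrite -big_split; apply: eq_bigr => j _; rewrite mulrDl.
Qed.

(** Each monomial that remains in [q] is a multiple of one generator. When [i]
    is not the last index the ideal also contains [f ^ d_{n+1}], which is why
    this gives only a sufficient condition for membership. *)
Lemma in_other_ideal_monomials {k : fieldType} {n : nat} (d : 'I_n.+1 -> nat)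
    (i : 'I_n.+1) (q : {mpoly k[n]}) :
    (forall m : 'X_{1..n},
       (forall j : 'I_n, lift ord_max j != i -> (m j < d (lift ord_max j))%N) ->
       q@_m = 0) ->
  in_other_ideal d i q.
Proof.
move=> hq; rewrite [q]mpolyE big_seq; apply: in_other_ideal_sum => m.
rewrite mcoeff_msupp => qm.
have [j ji dm] : exists2 j : 'I_n, lift ord_max j != i &
    (d (lift ord_max j) <= m j)%N.
  have [/existsP[j /andP[ji dm]]|/existsPn none] := boolP [exists j : 'I_n,
      (lift ord_max j != i) && (d (lift ord_max j) <= m j)%N].
    by exists j.
  case/eqP: qm; apply: hq => j ji.
  by move: (none j); rewrite ji -ltnNge.
have -> : 'X_[m] = 'X_[(m - U_(j) *+ d (lift ord_max j))]
            * Defs.form k (lift ord_max j) ^+ d (lift ord_max j).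
  rewrite form_lift mpolyXn -mpolyXD submK //; apply/mnm_lepP => l.
  by rewrite mulmnE mnm1E; case: eqP => [<-|_]; rewrite ?mul1n ?mul0n.
by rewrite scalerAl; apply: in_other_ideal_term.
Qed.

(** This is the regularity of the sequence of the powers [x_j ^ e_j], read on
    monomials: the coefficient of the relation at [x_i ^ e_i * x ^ m] can only
    come from the [i]-th term. *)
Lemma power_syzygy {k : fieldType} {n : nat} (e : 'I_n -> nat)
    (b : 'I_n -> {mpoly k[n]}) (i : 'I_n) (m : 'X_{1..n}) :
    \sum_j b j * 'X_j ^+ e j = 0 ->
    (forall j, j != i -> (m j < e j)%N) ->
  (b i)@_m = 0.
Proof.
move=> syz small.
have := congr1 (mcoeff (U_(i) *+ e i + m)%MM) syz.
rewrite mcoeff0 raddf_sum /= (bigD1 i) //= mpolyXn mcoeffMX.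
rewrite big1 ?addr0 // => j ji; rewrite mpolyXn mcoeffMX_eq0 //.
apply/mnm_lepP => /(_ j); rewrite mnmDE !mulmnE !mnm1E eqxx mul1n.
by rewrite eq_sym (negbTE ji) mul0n add0n leqNgt small.
Qed.

(** If the last entry is [\sum_j c_j x_j ^ d_j], substituting it into the
    relation leaves a relation on the [x_j ^ d_j] alone, with entries
    [b_j = a_j + c_j f ^ d_{n+1}]. By regularity [b_j] lies in the ideal of the
    other powers of variables, so [a_j] lies in the ideal of the other
    generators, for every [j]. *)
Lemma non_Koszul_last {k : fieldType} {n : nat} (d : 'I_n.+1 -> nat)
    (D : nat) (a : 'I_n.+1 -> {mpoly k[n]}) :
    is_relation d D a -> non_Koszul d a ->
  ~ in_other_ideal d ord_max (a ord_max).
Proof.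
move=> [_ rel] [i ai] last_in; apply: ai.
case: (unliftP ord_max i) => [l ->|-> //]; case: last_in => c ac.
pose e j := d (lift ord_max j); pose f : {mpoly k[n]} := Defs.form k ord_max.
pose b j := a (lift ord_max j) + c (lift ord_max j) * f ^+ d ord_max.
have but_last (F : 'I_n.+1 -> {mpoly k[n]}) :
    \sum_(j | j != ord_max) F j = \sum_(j < n) F (lift ord_max j).
  rewrite big_mkcond (bigD1_ord ord_max) //= eqxx add0r.
  by apply: eq_bigr => j _; rewrite eq_sym neq_lift.
have syz : \sum_j b j * 'X_j ^+ e j = 0.
  rewrite -[RHS]rel (bigD1_ord ord_max) //= ac but_last mulr_suml -big_split.
  by apply: eq_bigr => j _; rewrite form_lift mulrDl addrC [in LHS]mulrAC.
have -> : a (lift ord_max l) =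
    \sum_(x : bool) if x then b l else - c (lift ord_max l) * f ^+ d ord_max.
  by rewrite big_bool /= /b mulNr addrK.
apply: in_other_ideal_sum => -[] _; last first.
  by apply: in_other_ideal_term; rewrite neq_lift.
apply: in_other_ideal_monomials => m small; apply: power_syzygy syz _ => j jl.
by apply: small; rewrite (inj_eq lift_inj).
Qed.

(** * Annihilators in the monomial quotient *)

(** These monomials are a basis of the quotient by the [x_j ^ d_j], so a
    polynomial is zero in the quotient iff its coefficients at all of them
    vanish. *)
Definition standard {n : nat} (d : 'I_n.+1 -> nat) : pred 'X_{1..n} :=
  fun m => [forall j : 'I_n, m j < d (lift ord_max j)]%N.

Lemma standard_mcoeffM_eq0 {k : fieldType} {n : nat} (d : 'I_n.+1 -> nat)
    (p q : {mpoly k[n]}) :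
    (forall m, standard d m -> p@_m = 0) ->
  forall m, standard d m -> (p * q)@_m = 0.
Proof.
move=> hp m /forallP sm; rewrite mcoeffM big1 // => -[m1 m2] /= /eqP em.
rewrite hp ?mul0r //; apply/forallP => j.
apply: leq_ltn_trans (sm j).
by rewrite [leqRHS](congr1 (fun x : 'X_{1..n} => x j) em) mnmDE leq_addr.
Qed.

Definition standard_part {k : fieldType} {n : nat} (d : 'I_n.+1 -> nat)
    (p : {mpoly k[n]}) : {mpoly k[n]} :=
  \sum_(m <- msupp p | standard d m) p@_m *: 'X_[m].

Lemma mcoeff_standard_part {k : fieldType} {n : nat} (d : 'I_n.+1 -> nat)
    (p : {mpoly k[n]}) (m : 'X_{1..n}) :
  (standard_part d p)@_m = if standard d m then p@_m else 0.
Proof.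
rewrite /standard_part big_mkcond raddf_sum /=.
case: ifP => sm; last first.
  apply: big1 => m' _; case: ifP => [sm'|]; last by rewrite mcoeff0.
  rewrite mcoeffZ mcoeffX; case: eqP => [e|]; last by rewrite mulr0.
  by rewrite -e sm' in sm.
rewrite [RHS](congr1 (mcoeff m) (mpolyE p)) raddf_sum /=.
apply: eq_bigr => m' _; case: ifP => // sm'; rewrite mcoeff0 mcoeffZ mcoeffX.
by case: eqP => [e|]; [rewrite e sm in sm' | rewrite mulr0].
Qed.

Lemma map_form_max {k : fieldType} {n : nat} :
  map_mpoly intr (\sum_(j < n) 'X_j) = Defs.form k ord_max.
Proof.
by rewrite form_max raddf_sum /=; apply: eq_bigr => j _; rewrite map_mpolyX.
Qed.

(** The witness is the standard part of the last entry: it represents the same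
    class in the quotient, and it is nonzero because that class is. *)
Lemma standard_annihilator {k : fieldType} {n : nat} (d : 'I_n.+1 -> nat)
    (D : nat) :
    non_Koszul_degree k d D ->
  exists g : {mpoly k[n]}, exists e, [/\ g != 0, g \is e.-homog,
    (e + d ord_max)%N = D, {subset msupp g <= standard d} &
    forall m, standard d m -> (g * Defs.form k ord_max ^+ d ord_max)@_m = 0].
Proof.
case=> a rel nK; have last_out := non_Koszul_last _ _ _ rel nK.
set u := a ord_max in last_out *.
have gu_neq0 : standard_part d u != 0.
  apply/eqP => g0; apply: last_out; apply: in_other_ideal_monomials => m sm.
  have := mcoeff_standard_part d u m; rewrite g0 mcoeff0 => ->.
  by rewrite ifT //; apply/forallP => j; apply: sm; rewrite eq_sym neq_lift.
have u_neq0 : u != 0.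
  by apply: contraNneq gu_neq0 => ->; rewrite /standard_part msupp0 big_nil.
case: rel => /(_ _ u_neq0)[e ue eD] rel.
exists (standard_part d u), e; split=> //.
- rewrite /standard_part big_seq_cond; apply: rpred_sum => m /andP[mu _].
  by apply: rpredZ; rewrite dhomogX /= (dhomog_mf ue mu).
- move=> m; rewrite mcoeff_msupp mcoeff_standard_part.
  by rewrite unfold_in; case: ifP => //; rewrite eqxx.
move=> m sm.
(* The discarded monomials lie in the ideal, so the product of their sum with
   the power of [f] has no standard monomials either. *)
have split_u : standard_part d u = u - (u - standard_part d u) by rewrite subKr.
rewrite split_u mulrBl mcoeffB (standard_mcoeffM_eq0 d (u - _)) // => [|m' sm'];
  last by rewrite mcoeffB mcoeff_standard_part sm' subrr.
rewrite subr0; move/eqP: rel.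
rewrite (bigD1_ord ord_max) //= addr_eq0 -/u => /eqP ->.
rewrite mcoeffN raddf_sum big1 ?oppr0 //= => j _.
rewrite form_lift mpolyXn mcoeffMX_eq0 //; apply/mnm_lepP => /(_ j).
by rewrite mulmnE mnm1E eqxx mul1n leqNgt; move/forallP: sm => ->.
Qed.

(** Since [g * f ^ d_{n+1}] is homogeneous and lies in the ideal of the
    [x_j ^ d_j], its homogeneous cofactors, negated, complete [g] to a relation.
    A nonzero combination of standard monomials is not in that ideal. *)
Lemma annihilator_non_Koszul_degree {k : fieldType} {n : nat}
    (d : 'I_n.+1 -> nat) (e : nat) (g : {mpoly k[n]}) :
    g != 0 -> g \is e.-homog -> {subset msupp g <= standard d} ->
    (forall m, standard d m -> (g * Defs.form k ord_max ^+ d ord_max)@_m = 0) ->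
  non_Koszul_degree k d (e + d ord_max).
Proof.
move=> g_neq0 ge gst gf.
have gfh : g * Defs.form k ord_max ^+ d ord_max \is (e + d ord_max).-homog.
  by apply: dhomogM => //; rewrite form_max; apply: fX_homog.
have [|c ch cE] := all_big_decomp (d := d) gfh.
  apply/allP => m; rewrite mcoeff_msupp; apply: contraR => /existsPn big.
  by apply/eqP/gf/forallP => j; rewrite ltnNge.
exists (fun i => if unlift ord_max i is Some j then - c j else g).
  split=> [i|].
    case: unliftP => [j ->|-> _]; last by exists e.
    by rewrite oppr_eq0 => /ch[e' he <-]; exists e' => //; rewrite dhomogN.
  rewrite (bigD1_ord ord_max) //= unlift_none cE -big_split big1 //= => j _.
  by rewrite liftK form_lift mulNr subrr.
exists ord_max; rewrite unlift_none => /in_other_ideal_max_big /allP big.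
case/eqP: g_neq0; apply/mpolyP => m; rewrite mcoeff0; apply: memN_msupp_eq0.
apply/negP => mg; have /existsP[j] := big m mg.
by rewrite leqNgt; have /forallP -> := gst m mg.
Qed.

Theorem theorem1p5 (n : nat) (n_gt0 : (0 < n)%N) (d : 'I_n.+1 -> nat)
    (d_gt0 : forall i, (0 < d i)%N)
    (d_le : forall i, (d i <= \sum_(j < n.+1 | j != i) (d j - 1))%N)
    (p : nat) (p_prime : prime p)
    (kp : fieldType) (char_kp : (p \in [pchar kp])%R)
    (k0 : fieldType) (char_k0 : ([pchar k0] =i pred0)%R) :
  (min_non_Koszul_degree kp d_gt0 <= min_non_Koszul_degree k0 d_gt0)%N.
Proof.
have [nK0 _] := min_non_Koszul_degreeP k0 d_gt0.
have [_] := min_non_Koszul_degreeP kp d_gt0; apply.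
have [g0 [e [g0_neq0 g0e <- g0st g0f]]] := standard_annihilator _ _ nK0.
have formE k : map_mpoly intr ((\sum_(j < n) 'X_j) ^+ d ord_max)
    = Defs.form k ord_max ^+ d ord_max by rewrite rmorphXn /= map_form_max.
have [|g [g_neq0 g_sub gf]] := annihilator_transfer (k := kp)
  ((\sum_(j < n) 'X_j) ^+ d ord_max) (standard d) g0 char_k0 g0_neq0.
  by rewrite formE.
rewrite formE in gf; apply: annihilator_non_Koszul_degree g_neq0 _ _ gf.
  by apply/dhomogP => m /g_sub; apply: dhomog_mf.
by move=> m /g_sub /g0st.
Qed.
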